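(* Let $A\subseteq\mathbb{P}$ (the positive integers) and let $F^{\mathrm{asc}}(A;x)=\sum_{n\ge0}c_nx^n$, where $c_n$ is the number of Motzkin paths of length $n$ in which every ascent ends at a height in $A$. For $i\ge1$ let $C_i=x^2$ if $i\notin A$ and $C_i=0$ otherwise. Then \[ F^{\mathrm{asc}}(A;x)=\cfrac{1}{1-x+C_1-\cfrac{x^2-xC_1}{1-x+C_2-\cfrac{x^2-xC_2}{1-x+C_3-\cdots}}}. \]
   Context: A Motzkin path of length $n$ is a sequence of $n$ steps $U$ ($+1$), $F$ ($0$), $D$ ($-1$) starting and ending at height $0$ and never going below $0$. An ascent is a maximal run of consecutive $U$ steps; it ends at the height reached after its last $U$ step. An infinite continued fraction denotes the formal power series limit of its finite truncations. *)

(* Defs.v *)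
From HB Require Import structures.
From mathcomp Require Import all_boot all_order all_algebra.
From mathcomp Require Import boolp classical_sets.

Set Implicit Arguments.
Unset Strict Implicit.
Unset Printing Implicit Defensive.

Import GRing.Theory.
Local Open Scope ring_scope.

Section PowerSeries.
Variable R : nzRingType.

Record fps := Fps { coefs : nat -> R }.

Lemma fpsP (f g : fps) : (forall n, coefs f n = coefs g n) <-> f = g.
Proof.
split=> [|-> //]; case: f g => [f] [g] /= fg.
by congr Fps; apply/funext.
Qed.

HB.instance Definition _ := gen_eqMixin fps.
HB.instance Definition _ := gen_choiceMixin fps.

Definition fps0 := Fps (fun=> 0).
Definition fps_opp f := Fps (fun n => - coefs f n).
Definition fps_add f g := Fps (fun n => coefs f n + coefs g n).

Fact fps_addA : associative fps_add.
Proof. by move=> f g h; apply/fpsP => n /=; rewrite addrA. Qed.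
Fact fps_addC : commutative fps_add.
Proof. by move=> f g; apply/fpsP => n /=; rewrite addrC. Qed.
Fact fps_add0 : left_id fps0 fps_add.
Proof. by move=> f; apply/fpsP => n /=; rewrite add0r. Qed.
Fact fps_addN : left_inverse fps0 fps_opp fps_add.
Proof. by move=> f; apply/fpsP => n /=; rewrite addNr. Qed.

HB.instance Definition _ :=
  GRing.isZmodule.Build fps fps_addA fps_addC fps_add0 fps_addN.

Definition fps1 := Fps (fun n => (n == 0)%:R).
Definition fps_mul f g :=
  Fps (fun n => \sum_(i < n.+1) coefs f i * coefs g (n - i)%N).

Let tr N f := \poly_(i < N.+1) coefs f i.

Let coef_tr N f n : (n <= N)%N -> (tr N f)`_n = coefs f n.
Proof. by move=> nN; rewrite coef_poly ltnS nN. Qed.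

Let coef_mul_tr N f g n : (n <= N)%N ->
  coefs (fps_mul f g) n = (tr N f * tr N g)`_n.
Proof.
move=> nN; rewrite coefM; apply: eq_bigr => i _.
have iN : (i <= N)%N by rewrite (leq_trans _ nN) // -ltnS.
by rewrite !coef_tr // (leq_trans (leq_subr _ _)).
Qed.

Fact fps_mulA : associative fps_mul.
Proof.
move=> f g h; apply/fpsP => n.
transitivity (tr n f * (tr n g * tr n h))`_n.
  rewrite coefM; apply: eq_bigr => i _.
  by rewrite coef_tr -1?ltnS // -coef_mul_tr // leq_subr.
rewrite mulrA coefM; apply: eq_bigr => i _.
by rewrite -coef_mul_tr -1?ltnS // coef_tr // leq_subr.
Qed.

Fact fps_mul1f : left_id fps1 fps_mul.
Proof.
move=> f; apply/fpsP => n /=; rewrite big_ord_recl /= mul1r subn0 big1 ?addr0 //.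
by move=> i _; rewrite mul0r.
Qed.

Fact fps_mulf1 : right_id fps1 fps_mul.
Proof.
move=> f; apply/fpsP => n /=; rewrite big_ord_recr /= subnn mulr1 big1 ?add0r //.
by move=> i _; rewrite subn_eq0 leqNgt ltn_ord mulr0.
Qed.

Fact fps_mulDl : left_distributive fps_mul fps_add.
Proof.
move=> f g h; apply/fpsP => n /=; rewrite -big_split /=.
by apply: eq_bigr => i _; rewrite mulrDl.
Qed.

Fact fps_mulDr : right_distributive fps_mul fps_add.
Proof.
move=> f g h; apply/fpsP => n /=; rewrite -big_split /=.
by apply: eq_bigr => i _; rewrite mulrDr.
Qed.

Fact fps_1neq0 : fps1 != 0.
Proof. by apply/eqP => /fpsP /(_ 0%N) /= /eqP; rewrite oner_eq0. Qed.

HB.instance Definition _ := GRing.Zmodule_isNzRing.Build fps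
  fps_mulA fps_mul1f fps_mulf1 fps_mulDl fps_mulDr fps_1neq0.

Definition fpsX : fps := Fps (fun n => (n == 1)%:R).

Lemma coefs0 n : coefs (0 : fps) n = 0. Proof. by []. Qed.
Lemma coefs1 n : coefs (1 : fps) n = (n == 0)%:R. Proof. by []. Qed.
Lemma coefsX n : coefs fpsX n = (n == 1)%:R. Proof. by []. Qed.
Lemma coefsN (f : fps) n : coefs (- f) n = - coefs f n. Proof. by []. Qed.
Lemma coefsD (f g : fps) n : coefs (f + g) n = coefs f n + coefs g n.
Proof. by []. Qed.
Lemma coefsM (f g : fps) n :
  coefs (f * g) n = \sum_(i < n.+1) coefs f i * coefs g (n - i)%N.
Proof. by []. Qed.

Definition fps_lim (u : nat -> fps) (f : fps) :=
  forall n, exists N, forall m, (N <= m)%N -> coefs (u m) n = coefs f n.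

End PowerSeries.

Arguments fpsX {R}.
Notation "{ 'fps' R }" := (fps R) (format "{ 'fps'  R }").

Section ComPowerSeries.
Variable R : comUnitRingType.
Implicit Types f g : {fps R}.

Fact fps_mulC : commutative (@fps_mul R).
Proof.
move=> f g; apply/fpsP => n /=; rewrite (reindex_inj rev_ord_inj) /=.
by apply: eq_bigr => i _; rewrite subSS subKn -1?ltnS // mulrC.
Qed.

HB.instance Definition _ := GRing.PzRing_hasCommutativeMul.Build {fps R} fps_mulC.

Definition fps_unit : pred {fps R} := fun f => coefs f 0 \is a GRing.unit.

(* First n.+1 coefficients g_0, ..., g_n of the inverse g of f, obtained by    *)
(* solving f_0 g_n + f_1 g_(n-1) + ... + f_n g_0 = (n == 0)%:R for g_n.        *)
Fixpoint inv_prefix f n : seq R :=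
  if n is n'.+1 then
    let s := inv_prefix f n' in
    rcons s (- (coefs f 0)^-1 * \sum_(i < n) coefs f i.+1 * s`_(n' - i))
  else [:: (coefs f 0)^-1].

(* As everywhere in the hierarchy, the inverse of a non-unit is itself.        *)
Definition fps_inv f : {fps R} :=
  if fps_unit f then Fps (fun n => (inv_prefix f n)`_n) else f.

Let size_inv_prefix f n : size (inv_prefix f n) = n.+1.
Proof. by elim: n => //= n IHn; rewrite size_rcons IHn. Qed.

Let nth_inv_prefix f n k :
  (k <= n)%N -> (inv_prefix f n)`_k = (inv_prefix f k)`_k.
Proof.
elim: n => [|n IHn]; first by rewrite leqn0 => /eqP ->.
rewrite leq_eqVlt => /predU1P[-> //|kn].
by rewrite [inv_prefix f n.+1]/= nth_rcons size_inv_prefix kn IHn.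
Qed.

Fact fps_mulVf : {in fps_unit, left_inverse 1 fps_inv *%R}.
Proof.
move=> f uf; rewrite mulrC; apply/fpsP => n.
have uf0 : coefs f 0 \is a GRing.unit by [].
rewrite coefsM coefs1 /fps_inv [fps_unit f]uf big_ord_recl subn0.
case: n => [|n]; first by rewrite big_ord0 addr0 /= divrr.
rewrite [coefs _ n.+1]/= nth_rcons size_inv_prefix ltnn eqxx.
rewrite mulNr mulrN mulVKr // addrC; apply/eqP; rewrite subr_eq0; apply/eqP.
apply: eq_bigr => i _; rewrite lift0 subSS /=.
by rewrite (@nth_inv_prefix f n) ?leq_subr.
Qed.

Fact fps_unitP f g : g * f = 1 -> fps_unit f.
Proof.
move=> /fpsP /(_ 0%N); rewrite coefsM big_ord1 coefs1 => gf1.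
by apply/unitrPr; exists (coefs g 0); rewrite mulrC.
Qed.

Fact fps_inv_out : {in [predC fps_unit], fps_inv =1 id}.
Proof. by move=> f /negbTE nuf; rewrite /fps_inv [fps_unit f]nuf. Qed.

HB.instance Definition _ := GRing.ComNzRing_hasMulInverse.Build {fps R}
  fps_mulVf fps_unitP fps_inv_out.

Lemma fps_unitE f : (f \is a GRing.unit) = (coefs f 0 \is a GRing.unit).
Proof. by []. Qed.

(* b i - a i / (b i.+1 - a i.+1 / (... - a (i + m).-1 / b (i + m)))            *)
Fixpoint cfrac_den (a b : nat -> {fps R}) (i m : nat) : {fps R} :=
  if m is m'.+1 then b i - a i / cfrac_den a b i.+1 m' else b i.

Definition cfrac_trunc (a b : nat -> {fps R}) (m : nat) : {fps R} :=
  1 / cfrac_den a b 1 m.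

(* f = 1 / (b 1 - a 1 / (b 2 - a 2 / (b 3 - ...)))                             *)
Definition is_cfrac (a b : nat -> {fps R}) (f : {fps R}) :=
  fps_lim (cfrac_trunc a b) f.

(* No division by a non-unit occurs when every b i has constant term 1 and     *)
(* every a i has constant term 0.                                              *)
Lemma cfrac_den_unit (a b : nat -> {fps R}) i m :
  (forall k, coefs (a k) 0 = 0) -> (forall k, coefs (b k) 0 = 1) ->
  cfrac_den a b i m \is a GRing.unit.
Proof.
move=> a0 b0; rewrite fps_unitE; case: m => [|m] /=; first by rewrite b0 unitr1.
by rewrite big_ord1 a0 mul0r oppr0 addr0 b0 unitr1.
Qed.

End ComPowerSeries.

Inductive step := U | F | D.

Definition step_to_ord (s : step) : 'I_3 :=
  match s with U => inord 0 | F => inord 1 | D => inord 2 end.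
Definition ord_to_step (i : 'I_3) : step :=
  match val i with 0 => U | 1 => F | _ => D end.
Fact step_to_ordK : cancel step_to_ord ord_to_step.
Proof. by case; rewrite /ord_to_step /= inordK. Qed.

HB.instance Definition _ := Countable.copy step (can_type step_to_ordK).
HB.instance Definition _ : isFinite step := CanIsFinite step_to_ordK.

Definition step_val (s : step) : int :=
  match s with U => 1 | F => 0 | D => -1 end.

(* Height reached after the first i steps.                                     *)
Definition height (p : seq step) (i : nat) : int :=
  \sum_(s <- take i p) step_val s.

Definition is_motzkin (p : seq step) : bool :=
  (height p (size p) == 0) && [forall i : 'I_(size p).+1, 0 <= height p i].

(* The steps of p numbered i, ..., j - 1 (counting from 0) form a maximal      *)
(* nonempty run of U steps; its last step leads to height p j.                 *)
Definition is_ascent (p : seq step) (i j : nat) : bool :=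
  [&& (i < j <= size p)%N,
      all (pred1 U) (drop i (take j p)),
      (i == 0) || (nth U p i.-1 != U) &
      (j == size p) || (nth U p j != U)].

Definition ascents_end_in (A : set nat) (p : seq step) : bool :=
  [forall i : 'I_(size p).+1, forall j : 'I_(size p).+1,
     is_ascent p i j ==> (height p j \in [set a%:Z | a in A]%classic)].

Definition num_motzkin_asc (A : set nat) (n : nat) : nat :=
  #|[pred p : n.-tuple step | is_motzkin p && ascents_end_in A p]|.

Definition Fasc (A : set nat) : {fps int} :=
  Fps (fun n => (num_motzkin_asc A n)%:Z).

(* Main.v *)
Require Import Defs.
From HB Require Import structures.
From mathcomp Require Import all_boot all_order all_algebra.
From mathcomp Require Import boolp classical_sets.
From mathcomp Require Import zify ring.

Import GRing.Theory.
Local Open Scope ring_scope.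

(** Read a path from left to right, remembering the current height [h] and
    whether the last step was [U].  The generating functions of the admissible
    completions satisfy a linear system, triangular in the length, hence with a
    unique solution.  Let [E h] be the tail of the continued fraction starting
    at level [h + 1], that is
      [E h * (1 - x + C (h + 1) - (x^2 - x C (h + 1)) * E (h + 1)) = 1].
    Then the system is solved by [x^h E_h E_(h-1) ... E_0] for completions from
    height [h] whose previous step is not [U], and by the same product with
    [E_h] replaced by [(1 - x) E_h - 1] when [h] is not in [A] for those whose
    previous step is [U].  Truncating the fraction after [m] levels only
    perturbs coefficients of degree larger than [m]. *)

(** * Step-by-step recognition of admissible paths *)

Fixpoint completes (A : set nat) (h : nat) (b : bool) (p : seq step) : bool :=
  match p with
  | [::] => (b ==> (h \in A)) && (h == 0)
  | U :: q => completes A h.+1 true q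
  | F :: q => (b ==> (h \in A)) && completes A h false q
  | D :: q => (b ==> (h \in A)) &&
      (if h is h'.+1 then completes A h' false q else false)
  end.

Lemma step_eqE : (((U == F) = false) * ((U == D) = false) * ((F == U) = false) *
  ((F == D) = false) * ((D == U) = false) * ((D == F) = false))%type.
Proof. by do !split; apply/eqP. Qed.

Lemma height_rec (p : seq step) i :
  height p i = if p is s :: q then
                 if i is j.+1 then step_val s + height q j else 0
               else 0.
Proof.
by case: p i => [|s p] [|i]; rewrite /height /= ?big_nil ?big_cons.
Qed.

Lemma motzkin_consP (z : int) (s : step) (p : seq step) :
  (z + height (s :: p) (size p).+1 = 0 /\
     forall i, (i <= (size p).+1)%N -> 0 <= z + height (s :: p) i) <->
  [/\ 0 <= z, (z + step_val s) + height p (size p) = 0 &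
     forall i, (i <= size p)%N -> 0 <= (z + step_val s) + height p i].
Proof.
rewrite height_rec addrA; split=> [[z0 zp]|[z0 zs zp]]; split=> //.
- by have := zp 0 isT; rewrite height_rec addr0.
- by move=> i ip; have := zp i.+1 ip; rewrite height_rec addrA.
- by case=> [|i] ip; rewrite height_rec ?addr0 // addrA; apply: zp.
Qed.

Definition U_before (b : bool) (p : seq step) (j : nat) : bool :=
  if j is i.+1 then nth F p i == U else b.

(** Local form of the ascent condition for a word started at height [z]: an ascent ends exactly
    where a [U] is not followed by another [U]. Only its end matters, and [b] carries the one bit
    needed from the past. The default [F] makes the end of the word close a pending ascent. *)
Definition peaks_in (A : set nat) (z : int) (b : bool) (p : seq step) : Prop :=
  forall j, (j <= size p)%N -> U_before b p j -> nth F p j != U ->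
    z + height p j \in [set a%:Z | a in A]%classic.

Lemma mem_Posz_image (A : set nat) (h : nat) :
  (h%:Z \in [set a%:Z | a in A]%classic) = (h \in A).
Proof.
apply/idP/idP; rewrite !inE /=; last by exists h.
by case=> a Aa [<-].
Qed.

Lemma peaks_in_cons (A : set nat) (h : nat) (b : bool) (s : step) p :
  peaks_in A h%:Z b (s :: p) <->
  ((s != U) ==> b ==> (h \in A)) /\ peaks_in A (h%:Z + step_val s) (s == U) p.
Proof.
split=> [peaks|[ok peaks]].
  split=> [|j jp Uj NUj].
    apply/implyP=> NUs; apply/implyP=> bT.
    by have := peaks 0 isT bT NUs; rewrite height_rec addr0 mem_Posz_image.
  have := peaks j.+1 jp; rewrite height_rec addrA; apply=> //.
  by case: j Uj {jp NUj}.
case=> [_ /= bT NUs|j jp Uj NUj].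
  by rewrite height_rec addr0 mem_Posz_image; move: ok; rewrite NUs bT.
by rewrite height_rec addrA; apply: peaks => //; case: j Uj {jp NUj}.
Qed.

Lemma completesP (A : set nat) (h : nat) (b : bool) (p : seq step) :
  reflect [/\ h%:Z + height p (size p) = 0,
              forall i, (i <= size p)%N -> 0 <= h%:Z + height p i &
              peaks_in A h%:Z b p]
          (completes A h b p).
Proof.
suff: completes A h b p <-> [/\ h%:Z + height p (size p) = 0,
              forall i, (i <= size p)%N -> 0 <= h%:Z + height p i &
              peaks_in A h%:Z b p].
  by move=> [H1 H2]; apply: (iffP idP).
elim: p h b => [|s p IHp] h b.
  split=> [/= /andP[ok /eqP h0]|[h0 _ peaks] /=].
    split=> [|i _|j _]; rewrite height_rec addr0 ?h0 //.
    case: j => [bT _|j /=]; last by rewrite nth_nil step_eqE.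
    by rewrite mem_Posz_image -h0 (implyP ok).
  apply/andP; split; last by move: h0; rewrite height_rec; lia.
  apply/implyP=> bT; have := peaks 0 isT bT; rewrite nth_nil step_eqE => /(_ isT).
  by rewrite height_rec addr0 mem_Posz_image.
have -> : ([/\ h%:Z + height (s :: p) (size (s :: p)) = 0,
   forall i, (i <= size (s :: p))%N -> 0 <= h%:Z + height (s :: p) i &
   peaks_in A h%:Z b (s :: p)]) <->
   ((s != U) ==> b ==> (h \in A)) /\
   [/\ (h%:Z + step_val s) + height p (size p) = 0,
     forall i, (i <= size p)%N -> 0 <= (h%:Z + step_val s) + height p i &
     peaks_in A (h%:Z + step_val s) (s == U) p].
  split=> [[H1 H2 /peaks_in_cons[ok H3]]|[ok [H1 H2 H3]]].
    by have /motzkin_consP[_ H4 H5] := conj H1 H2.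
  have /motzkin_consP[H4 H5] : [/\ 0 <= h%:Z,
     (h%:Z + step_val s) + height p (size p) = 0 &
     forall i, (i <= size p)%N -> 0 <= (h%:Z + step_val s) + height p i] by [].
  by split=> //; apply/peaks_in_cons.
case: s; rewrite ?eqxx ?step_eqE /=.
- by rewrite IHp -[1]/(1%:Z) -PoszD addn1; split=> [|[]].
- by rewrite addr0 -IHp; split=> [/andP[]|[-> ->]].
- case: h => [|h].
    (* A [D] at height 0 is excluded on the right because the rest would start at height -1. *)
    split=> [|[_ [_ /(_ 0 isT)]]]; rewrite ?andbF //.
    by rewrite height_rec; case: p {IHp}.
  have -> : h.+1%:Z + -1 = h%:Z by lia.
  by rewrite -IHp; split=> [/andP[]|[-> ->]].
Qed.

Lemma all_drop_takeP (T : Type) (x0 : T) (P : pred T) (s : seq T) i j :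
  (j <= size s)%N ->
  reflect (forall k, (i <= k < j)%N -> P (nth x0 s k)) (all P (drop i (take j s))).
Proof.
move=> js; have sz : size (take j s) = j by rewrite size_takel.
apply: (iffP (all_nthP x0)) => Ps k.
  move=> /andP[ik kj]; have := Ps (k - i)%N.
  by rewrite size_drop sz nth_drop subnKC // nth_take // ltn_sub2r // => [->|]//; lia.
rewrite size_drop sz nth_drop => kj; rewrite nth_take; last by lia.
by apply: Ps; lia.
Qed.

(** Walking left from [j] while [P] holds recovers the beginning of an ascent from its last [U]. *)
Lemma run_start (T : Type) (x0 : T) (P : pred T) (s : seq T) j :
  P (nth x0 s j) ->
  exists i, [/\ (i <= j)%N, forall k, (i <= k <= j)%N -> P (nth x0 s k) &
                (i == 0) || ~~ P (nth x0 s i.-1)].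
Proof.
elim: j => [|j IHj] Pj.
  by exists 0; split=> // k; rewrite leqn0 => /eqP->.
have [/IHj[i [ij Pi start]]|NP] := boolP (P (nth x0 s j)).
  exists i; split=> // [|k /andP[ik]]; first exact: leqW.
  by rewrite leq_eqVlt => /predU1P[-> //|kj]; apply: Pi; rewrite ik.
exists j.+1; split=> // k; rewrite -eqn_leq => /eqP<- //.
Qed.

Lemma ascents_end_inP (A : set nat) (p : seq step) :
  reflect (peaks_in A 0 false p) (ascents_end_in A p).
Proof.
apply: (iffP idP) => [/forallP asc j jp|peaks].
  case: j jp => // j jp /= Uj NUj; rewrite add0r.
  have [i [ij Ui start]] : exists i, [/\ (i <= j)%N,
      forall k, (i <= k <= j)%N -> nth U p k == U &
      (i == 0) || (nth U p i.-1 != U)].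
    by apply: (@run_start _ U (pred1 U)); rewrite (set_nth_default F).
  have ip : (i < (size p).+1)%N by lia.
  have /forallP/(_ (Ordinal (jp : (j.+1 < (size p).+1)%N)))/implyP := asc (Ordinal ip).
  apply; apply/and4P; split=> //=.
  - by rewrite ltnS ij.
  - by apply/(all_drop_takeP _ U).
  - have [//|ne] := eqVneq j.+1 (size p).
    by rewrite (set_nth_default F) // ltn_neqAle ne.
apply/forallP=> i; apply/forallP=> -[j /= jp].
apply/implyP=> /and4P[/andP[ij _] /(all_drop_takeP _ U) allU _ stop].
have := peaks j jp; rewrite add0r; apply.
  case: j ij jp allU {stop} => // j ij jp allU /=.
  rewrite (set_nth_default U) //; apply: allU => //.
  by rewrite -ltnS ij /=.
(* Beyond the word [nth F] returns [F], so an ascent that finishes the path also counts. *)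
have [le|lt] := leqP (size p) j; first by rewrite nth_default // step_eqE.
by move: stop; rewrite (set_nth_default F) // (ltn_eqF lt).
Qed.

Lemma motzkin_completes (A : set nat) (p : seq step) :
  is_motzkin p && ascents_end_in A p = completes A 0 false p.
Proof.
apply/idP/completesP => [/andP[/andP[/eqP p0 /forallP pge] /ascents_end_inP pA]|].
  by split=> // [|i ip]; rewrite add0r // (pge (Ordinal (ip : (i < (size p).+1)%N))).
case=> p0 pge pA; rewrite /is_motzkin -[height p _]add0r p0 eqxx /=.
apply/andP; split; last exact/ascents_end_inP.
by apply/forallP=> -[i ip]; rewrite -[height p _]add0r; apply: pge.
Qed.

(** * Counting completions by their first step *)

Definition num_completions (A : set nat) (h : nat) (b : bool) (n : nat) : nat :=
  #|[pred p : n.-tuple step | completes A h b p]|.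

Lemma card_cons_tuple (T : finType) (n : nat) (P : pred (seq T)) :
  #|[pred p : n.+1.-tuple T | P p]| =
  (\sum_(s : T) #|[pred p : n.-tuple T | P (s :: p)]|)%N.
Proof.
rewrite -sum1_card (partition_big (@thead n T) xpredT) //=.
apply: eq_bigr => s _; rewrite -sum1_card.
rewrite (reindex_onto (fun q : n.-tuple T => [tuple of s :: q])
                       (fun p => [tuple of behead p])) /=.
  apply: eq_bigl => q; rewrite !inE theadE eqxx andbT.
  by rewrite [X in _ && X](_ : _ = true) ?andbT //; apply/eqP/val_inj.
by move=> p /andP[_ /eqP <-]; rewrite -tuple_eta.
Qed.

Lemma sum_step (f : step -> nat) : (\sum_s f s = f U + f F + f D)%N.
Proof.
rewrite (bigD1 U) //= (bigD1 F) ?step_eqE //= (bigD1 D) ?step_eqE //=.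
by rewrite big1 ?addn0 ?addnA // => -[]; rewrite eqxx ?andbF.
Qed.

Lemma num_completions0 A h b :
  num_completions A h b 0 = (b ==> (h \in A)) && (h == 0).
Proof.
rewrite /num_completions; case E: (completes A h b [::]); move: (E) => /= ->.
  rewrite -[RHS]/((#|{: step}| ^ 0)%N) -card_tuple.
  by apply: eq_card => p; rewrite !inE tuple0 E.
by apply: eq_card0 => p; rewrite !inE tuple0 E.
Qed.

Lemma num_completionsS A h b n :
  num_completions A h b n.+1 =
  (num_completions A h.+1 true n +
   (b ==> (h \in A)) * (num_completions A h false n +
     (if h is h'.+1 then num_completions A h' false n else 0)))%N.
Proof.
rewrite /num_completions card_cons_tuple sum_step -addnA /=; congr addn.
case: (b ==> (h \in A)); rewrite /= ?mul1n ?mul0n.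
  by congr addn; case: h => //; rewrite card0.
by rewrite !card0.
Qed.

(** * Solving the recursion with the truncated fraction *)

Lemma coefs_XM0 (R : nzRingType) (f : {fps R}) : coefs (fpsX * f) 0 = 0.
Proof. by rewrite coefsM big_ord1 coefsX mul0r. Qed.

Lemma coefs_XMS (R : nzRingType) (f : {fps R}) n :
  coefs (fpsX * f) n.+1 = coefs f n.
Proof.
rewrite coefsM big_ord_recl big_ord_recl /= mul0r mul1r add0r subn1 /=.
by rewrite big1 ?addr0 // => i _; rewrite mul0r.
Qed.

Section TruncatedSolution.
Variables (A : set nat) (m : nat).

Let C : nat -> {fps int} := fun i => if i \in A then 0 else fpsX ^+ 2.
Let a i := fpsX ^+ 2 - fpsX * C i.
Let b i := 1 - fpsX + C i.

Let coefsC0 i : coefs (C i) 0 = 0.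
Proof. by rewrite /C; case: ifP => _; rewrite ?coefs0 // expr2 coefs_XM0. Qed.

Let den_unit i k : cfrac_den a b i k \is a GRing.unit.
Proof.
apply: cfrac_den_unit => j.
  by rewrite /a coefsD coefsN expr2 !coefs_XM0 oppr0 addr0.
by rewrite /b !coefsD coefsN coefsC0 coefs1 coefsX oppr0 !addr0.
Qed.

(** All [E h] are tails of the same truncation at depth [m]. The value 0 above [m] lets [E_rec] hold
    up to [h = m], where the denominator is just [b m.+1]. *)
Let E h : {fps int} :=
  if (h <= m)%N then (cfrac_den a b h.+1 (m - h))^-1 else 0.

Let E_rec h : (h <= m)%N -> E h * (b h.+1 - a h.+1 * E h.+1) = 1.
Proof.
move=> hm; have := mulVr (den_unit h.+1 (m - h)); rewrite /E hm.
move: hm; rewrite leq_eqVlt => /predU1P[->|hm].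
  by rewrite ltnn mulr0 subr0 subnn.
by rewrite hm subnS -(prednK (_ : 0 < m - h)%N) ?subn_gt0.
Qed.

(** Up to truncation, [E h] counts admissible excursions from [h] back to [h], never below [h],
    whose preceding step is not [U]. After a [U] ending at [h] outside [A], another [U] must follow:
    the empty excursion (1) and those starting with [F] ([fpsX * E h]) are removed. *)
Let G h := if h \in A then E h else (1 - fpsX) * E h - 1.

(** First-step decomposition of an excursion: empty, [F] first, or [U], a higher excursion, [D], and
    the rest. Written with [G], it is [E_rec] rearranged; [C h.+1] encodes the removal made in
    [G h.+1]. *)
Let E_G h : (h <= m)%N -> E h = 1 + fpsX * E h + fpsX ^+ 2 * G h.+1 * E h.
Proof.
move=> /E_rec; rewrite /G /a /b /C; case: ifP => _ Eh;
  apply/eqP; rewrite -subr_eq0 -(subrr 1) -{1}Eh; apply/eqP; ring.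
Qed.

(** Cutting at the first descents below [h], [h - 1], ..., 1 gives one excursion per level, with a
    factor [fpsX] for each such [D]. *)
Fixpoint after_nonU h : {fps int} :=
  if h is h'.+1 then fpsX * (E h * after_nonU h') else E 0.

(* Only meaningful at positive heights, the only ones a step [U] can reach. *)
Definition after_U h := fpsX * (G h * after_nonU h.-1).

Let after_nonU0 :
  after_nonU 0 = 1 + fpsX * (after_U 1 + after_nonU 0).
Proof. by rewrite /after_U /= {1}E_G //; ring. Qed.

Let after_nonUS h : (h < m)%N ->
  after_nonU h.+1 = fpsX * (after_U h.+2 + (after_nonU h.+1 + after_nonU h)).
Proof. by move=> hm; rewrite /after_U /= {1}E_G //; ring. Qed.

Let after_US h : (h < m)%N ->
  after_U h.+1 =
  fpsX * (after_U h.+2 + (after_nonU h.+1 + after_nonU h) *+ (h.+1 \in A)).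
Proof.
move=> /E_G Eh; rewrite /after_U /= {1}/G.
case: ifP => _ /=; rewrite ?mulr1n ?mulr0n; first by rewrite {1}Eh; ring.
(* The subtraction in [G] cancels the first two terms of [E_G], leaving only the one starting with
   [U]. *)
by rewrite [(1 - _) * _]mulrBl mul1r {1}Eh; ring.
Qed.

(** Each step lowers [n] by one and raises [h] by at most one, so [n + h <= m] persists and the
    recurrences are only used where truncation leaves them valid. *)
Lemma coefs_after n h : (n + h <= m)%N ->
  coefs (after_nonU h) n = (num_completions A h false n)%:Z /\
  ((0 < h)%N -> coefs (after_U h) n = (num_completions A h true n)%:Z).
Proof.
elim: n h => [|n IHn] h hm.
  rewrite !num_completions0; split=> [|h0].
    case: h hm => [|h] hm; last by rewrite coefs_XM0.
    by rewrite after_nonU0 coefsD coefs_XM0.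
  by rewrite coefs_XM0 (gtn_eqF h0) andbF.
have [_ /(_ isT) IHU] : _ /\ _ := IHn h.+1 (ltac:(lia)).
have [IHF _] : _ /\ _ := IHn h (ltac:(lia)).
rewrite !num_completionsS; case: h hm IHU IHF => [|h] hm IHU IHF.
  split=> //; rewrite after_nonU0 coefsD coefs_XMS coefsD IHU IHF coefs1.
  by rewrite add0r mul1n addn0 PoszD.
have [IHD _] : _ /\ _ := IHn h (ltac:(lia)).
split=> [|_].
  rewrite after_nonUS; last by lia.
  by rewrite coefs_XMS !coefsD IHU IHF IHD mul1n !PoszD.
rewrite after_US; last by lia.
rewrite coefs_XMS coefsD IHU PoszD; congr (_ + _).
by case: (_ \in A); rewrite ?mul0n // mul1n mulr1n coefsD IHF IHD PoszD.
Qed.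

Lemma coefs_cfrac_trunc n : (n <= m)%N ->
  coefs (cfrac_trunc a b m) n = (num_completions A 0 false n)%:Z.
Proof.
move=> nm; have [<- _] := coefs_after n 0 (ltac:(lia)).
by rewrite /cfrac_trunc mul1r /= /E leq0n subn0.
Qed.

End TruncatedSolution.

Theorem theorem9 (A : set nat)
    (hA : (A `<=` [set a : nat | (0 < a)%N])%classic) :
  let C : nat -> {fps int} := fun i => if i \in A then 0 else fpsX ^+ 2 in
  is_cfrac (fun i => fpsX ^+ 2 - fpsX * C i) (fun i => 1 - fpsX + C i)
    (Fasc A).
Proof.
(* The coefficient of degree [n] is already final at depth [n], so [n] is the threshold. *)
move=> C n; exists n => m nm; rewrite coefs_cfrac_trunc //=.
by congr Posz; apply: eq_card => p; rewrite !inE motzkin_completes.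
Qed.
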